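(* Let $E$ be a homogeneous effect algebra having the maximality property. Then every block $B$ of $E$ is a lattice (with respect to the order of the effect algebra $B$), and therefore $B$ satisfies the difference-meet property.
   Context: An effect algebra is a partial algebra $(E;\oplus,0,1)$ with $0\neq 1$ and a partial binary operation $\oplus$ such that for all $x,y,z\in E$: (1) $x\oplus y=y\oplus x$ if $x\oplus y$ is defined; (2) $(x\oplus y)\oplus z=x\oplus(y\oplus z)$ if one side is defined; (3) for every $x$ there is a unique $y$ (denoted $x'$) with $x\oplus y=1$; (4) if $1\oplus x$ is defined then $x=0$. One writes $x\le y$ and $y\ominus x=z$ iff $x\oplus z$ is defined and equals $y$; $\le$ is a partial order. A sub-effect algebra of $E$ is a subset $Q\subseteq E$ with $1\in Q$ such that whenever $x\oplus y=z$ in $E$ and two of $x,y,z$ lie in $Q$, all three lie in $Q$; it is an effect algebra with the inherited operation. $E$ satisfies the Riesz decomposition property if $u\le v_1\oplus v_2$ implies $u=u_1\oplus u_2$ for some $u_1\le v_1$, $u_2\le v_2$. $E$ is homogeneous if $u\le v_1\oplus v_2\le u'$ implies $u=u_1\oplus u_2$ for some $u_1\le v_1$, $u_2\le v_2$. A block of a homogeneous effect algebra $E$ is a maximal sub-effect algebra of $E$ with the Riesz decomposition property. $E$ has the maximality property if for every $u,v\in E$ the set $\{u,v\}$ has a maximal lower bound (a maximal element of the set of its lower bounds). An effect algebra satisfies the difference-meet property if, for all $x,y,z$ with $x\le y$ such that the meets $x\wedge z$ and $y\wedge z$ exist, the meet $(y\ominus x)\wedge z$ exists. *)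

(* Defs.v *)
From mathcomp Require Import all_boot.
From mathcomp Require Import boolp classical_sets.

Set Implicit Arguments.
Unset Strict Implicit.
Unset Printing Implicit Defensive.

Local Open Scope classical_set_scope.

(* A partial operation is an option-valued one: [oplus x y = Some z] reads
   "x (+) y is defined and equal to z".  With this encoding, an equality between
   options says that both sides are undefined, or both are defined and equal. *)
Record effect_algebra := EffectAlgebra {
  ea_car :> Type;
  oplus : ea_car -> ea_car -> option ea_car;
  ea0 : ea_car;
  ea1 : ea_car;
  ea0_neq1 : ea0 <> ea1;
  oplusC : forall x y, oplus x y = oplus y x;
  oplusA : forall x y z,
    obind (fun s => oplus s z) (oplus x y)
    = obind (fun s => oplus x s) (oplus y z);
  orthosupplement_ex : forall x, exists! y, oplus x y = Some ea1;
  oplus1_eq0 : forall x, oplus ea1 x <> None -> x = ea0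
}.
Arguments ea0 {_}.
Arguments ea1 {_}.

Section Order.
Variable E : effect_algebra.
Implicit Types x y z u v m : E.

Definition ortho x : E := projT1 (cid (orthosupplement_ex x)).

Lemma orthoP x y : oplus x y = Some ea1 <-> y = ortho x.
Proof.
rewrite /ortho; case: (cid _) => w /= [xw uw].
by split=> [/uw //|->].
Qed.

Definition ea_le x y : Prop := exists z, oplus x z = Some y.

(* [is_ominus y x z] : the difference of y and x is defined and equal to z. *)
Definition is_ominus y x z : Prop := oplus x z = Some y.

Definition lower_bound2 u v m : Prop := ea_le m u /\ ea_le m v.

Definition upper_bound2 u v m : Prop := ea_le u m /\ ea_le v m.

Definition is_meet u v m : Prop :=
  lower_bound2 u v m /\ forall l, lower_bound2 u v l -> ea_le l m.

Definition is_join u v m : Prop :=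
  upper_bound2 u v m /\ forall l, upper_bound2 u v l -> ea_le m l.

Definition maximal_lower_bound u v m : Prop :=
  lower_bound2 u v m /\
  forall l, lower_bound2 u v l -> ea_le m l -> l = m.

End Order.

Definition riesz_decomposition (E : effect_algebra) : Prop :=
  forall u v1 v2 v : E, oplus v1 v2 = Some v -> ea_le u v ->
  exists u1 u2 : E,
    [/\ ea_le u1 v1, ea_le u2 v2 & oplus u1 u2 = Some u].

Definition homogeneous (E : effect_algebra) : Prop :=
  forall u v1 v2 v : E, oplus v1 v2 = Some v ->
  ea_le u v -> ea_le v (ortho u) ->
  exists u1 u2 : E,
    [/\ ea_le u1 v1, ea_le u2 v2 & oplus u1 u2 = Some u].

Definition maximality_property (E : effect_algebra) : Prop :=
  forall u v : E, exists m, maximal_lower_bound u v m.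

Definition difference_meet (E : effect_algebra) : Prop :=
  forall x y z d : E, ea_le x y -> is_ominus y x d ->
  (exists m, is_meet x z m) -> (exists m, is_meet y z m) ->
  exists m, is_meet d z m.

Definition lattice_ordered (E : effect_algebra) : Prop :=
  forall x y : E, (exists m, is_meet x y m) /\ (exists j, is_join x y j).

(* The three closure conditions spell out "if two of x, y, z are in Q, so is the
   third", for x (+) y = z in E. *)
Record sub_effect_algebra (E : effect_algebra) := SubEffectAlgebra {
  sub_set :> set E;
  sub_ea1 : sub_set ea1;
  sub_oplus12 : forall x y z,
    oplus x y = Some z -> sub_set x -> sub_set y -> sub_set z;
  sub_oplus13 : forall x y z,
    oplus x y = Some z -> sub_set x -> sub_set z -> sub_set y;
  sub_oplus23 : forall x y z,
    oplus x y = Some z -> sub_set y -> sub_set z -> sub_set x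
}.

Section Induced.
Variables (E : effect_algebra) (Q : sub_effect_algebra E).

Lemma oplus10 : oplus (ea1 : E) ea0 = Some ea1.
Proof.
have [y [h _]] := orthosupplement_ex (ea1 : E).
by rewrite -(@oplus1_eq0 E y) ?h.
Qed.

Lemma sub_ea0 : sub_set Q ea0.
Proof. by apply: sub_oplus13 oplus10 _ _; exact: sub_ea1. Qed.

Let S := set_type Q.

(* By closure of Q, [insub] never fails on a defined sum: see [val_sub_op]. *)
Definition sub_op (x y : S) : option S := obind insub (oplus (val x) (val y)).

Lemma val_sub_op (x y : S) : omap val (sub_op x y) = oplus (val x) (val y).
Proof.
rewrite /sub_op; case h: (oplus _ _) => [z|] //=.
have Qz : z \in (Q : set E).
  by apply/mem_set; apply: (sub_oplus12 h); apply: set_mem; exact: valP.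
by rewrite (insubT (mem (Q : set E)) Qz).
Qed.

Lemma sub_opP (x y z : S) :
  sub_op x y = Some z <-> oplus (val x) (val y) = Some (val z).
Proof.
rewrite -val_sub_op; split=> [->//|].
by case: (sub_op x y) => [w /= [/val_inj ->]|].
Qed.

Definition sub0 : S := exist _ ea0 (mem_set sub_ea0).
Definition sub1 : S := exist _ ea1 (mem_set (sub_ea1 Q)).

Lemma sub0_neq1 : sub0 <> sub1.
Proof. by move/(congr1 val); exact: ea0_neq1. Qed.

Lemma sub_opC x y : sub_op x y = sub_op y x.
Proof. by rewrite /sub_op oplusC. Qed.

Lemma sub_opA x y z :
  obind (fun s => sub_op s z) (sub_op x y)
  = obind (fun s => sub_op x s) (sub_op y z).
Proof.
apply: (inj_omap val_inj).
have := oplusA (val x) (val y) (val z).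
rewrite -!val_sub_op.
by case: (sub_op x y) => [s|]; case: (sub_op y z) => [t|] //=;
  rewrite !val_sub_op.
Qed.

Lemma sub_orthosupplement_ex (x : S) : exists! y : S, sub_op x y = Some sub1.
Proof.
have [y [xy uy]] := orthosupplement_ex (val x).
have Qy : sub_set Q y.
  by apply: (sub_oplus13 xy); [apply: set_mem; exact: valP|exact: sub_ea1].
exists (exist _ y (mem_set Qy)); split; first exact/sub_opP.
by move=> w /sub_opP /uy yw; apply: val_inj.
Qed.

Lemma sub_op1_eq0 x : sub_op sub1 x <> None -> x = sub0.
Proof.
move=> h; apply: val_inj; apply: (@oplus1_eq0 E).
by move: h (val_sub_op sub1 x); case: (sub_op sub1 x) => [w|] // _ /= <-.
Qed.

Definition induced_effect_algebra : effect_algebra :=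
  EffectAlgebra sub0_neq1 sub_opC sub_opA sub_orthosupplement_ex sub_op1_eq0.

End Induced.

Definition block (E : effect_algebra) (B : sub_effect_algebra E) : Prop :=
  riesz_decomposition (induced_effect_algebra B) /\
  forall C : sub_effect_algebra E,
    riesz_decomposition (induced_effect_algebra C) ->
    B `<=` C -> C `<=` B.

(* Main.v *)
(* With [None] for "undefined", [option E] is a commutative monoid, so finite
   partitions of unity [p : T -> E] can be handled by big operators.

   Key fact: if B is a block and u <= b <= u' with b in B, then u is in B.
   Let K be the closure of B under this rule, sums and orthosupplements.  By
   homogeneity u splits along any partition of unity having b as a subsum, so
   partitions can be refined until all members of a given finite subset of K
   are subsums; this makes K a sub-effect algebra with the Riesz decomposition
   property, hence K = B by maximality.

   For x, y in B pick a partition of unity in B having both as subsums: x = a + b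
   and y = a + c with b + c defined.  A maximal lower bound m of b and c in E
   satisfies m <= b <= c' <= m', so m is in B.  The remainders b - m and c - m
   have no common lower bound but 0, so a + m is the meet of x and y in B. *)
From Stdlib Require List.
From HB Require Import structures.
From mathcomp Require Import all_boot.
From mathcomp Require Import boolp classical_sets.
Require Import Defs.

Set Implicit Arguments.
Unset Strict Implicit.
Unset Printing Implicit Defensive.

(** * The monoid of partial sums: cancellation, orthosupplements and order *)

Section OptionMonoid.
Variable E : effect_algebra.
Implicit Types (x y z u v w : E) (a b c : option E).

Definition oadd a b : option E := obind (fun x => obind (oplus x) b) a.

Lemma oaddC : commutative oadd.
Proof. by case=> [x|] [y|] //=; exact: oplusC. Qed.

Lemma oaddA : associative oadd.
Proof.
case=> [x|] [y|] [z|] //=; last by case: (oplus x y).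
by have := oplusA x y z; rewrite /oadd /=; do 2 case: (oplus _ _).
Qed.

Lemma oplus_ortho x : oplus x (ortho x) = Some ea1.
Proof. exact/orthoP. Qed.

Lemma orthoK x : ortho (ortho x) = x.
Proof. by apply/esym/orthoP; rewrite oplusC oplus_ortho. Qed.

(** Since x' + (x + 0) = 1 + 0 = 1, the sum x + 0 is the orthosupplement of x', which is x. *)
Lemma oplusx0 x : oplus x ea0 = Some x.
Proof.
have h : oadd (Some (ortho x)) (oadd (Some x) (Some ea0)) = Some ea1.
  by rewrite oaddA /= oplusC oplus_ortho /= oplus10.
case e: (oplus x ea0) h => [y|]; rewrite /= e //= => /orthoP.
by rewrite orthoK => ->.
Qed.

Lemma oadd0 : left_id (Some ea0) oadd.
Proof. by case=> [x|] //=; rewrite oplusC oplusx0. Qed.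

HB.instance Definition _ :=
  Monoid.isComLaw.Build (option E) (Some ea0) oadd oaddA oaddC oadd0.

Lemma oadd_some a b z : oadd a b = Some z ->
  exists x y, [/\ a = Some x, b = Some y & oplus x y = Some z].
Proof. by case: a b => [x|] [y|] //= h; exists x, y. Qed.

(** Both summands are the orthosupplement of x + z', and orthosupplements are unique. *)
Lemma oadd_inj x a b z :
  oadd (Some x) a = Some z -> oadd (Some x) b = Some z -> a = b.
Proof.
case: a b => [y|] // [w|] // h1 h2; congr Some.
have key t : oadd (Some x) (Some t) = Some z ->
    oadd (oadd (Some x) (Some (ortho z))) (Some t) = Some ea1.
  by move=> h; rewrite (AC (2*1) ((1*3)*2)) /= [oplus x t]h /= oplus_ortho.
have := key w h2; have := key y h1.
case: (oadd (Some x) (Some (ortho z))) => //= s.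
by move=> /orthoP -> /orthoP ->.
Qed.

Lemma oplus_inj x y w z : oplus x y = Some z -> oplus x w = Some z -> y = w.
Proof. by move=> h1 h2; case: (@oadd_inj x (Some y) (Some w) z h1 h2). Qed.

(** Adding 1 on the left shows that 1 + x is defined, which forces x = 0. *)
Lemma oplus_eq0 x y : oplus x y = Some ea0 -> x = ea0.
Proof.
move=> h; apply: oplus1_eq0 => e.
have : oadd (oadd (Some ea1) (Some x)) (Some y) = Some ea1.
  by rewrite -oaddA /= h /= oplus10.
by rewrite /= e.
Qed.

Lemma ortho_oplus x y z : oplus x y = Some z ->
  oplus (ortho z) x = Some (ortho y).
Proof.
move=> h.
have : oadd (Some y) (oadd (Some (ortho z)) (Some x)) = Some ea1.
  by rewrite (AC (1*2) ((3*1)*2)) /= h /= oplus_ortho.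
by rewrite [oadd (Some _) (Some x)]/=; case: (oplus _ x) => [t|] //= /orthoP ->.
Qed.

Lemma ea_le0 x : ea_le x ea0 -> x = ea0.
Proof. by case=> y /oplus_eq0. Qed.

Lemma ea_le_trans y x z : ea_le x y -> ea_le y z -> ea_le x z.
Proof.
move=> [s xs] [t yt].
have : oadd (Some x) (oadd (Some s) (Some t)) = Some z.
  by rewrite oaddA /= xs /= yt.
by move/oadd_some=> [_ [w [[<-] _ h]]]; exists w.
Qed.

Lemma ea_le_ortho x y : ea_le x y -> ea_le (ortho y) (ortho x).
Proof. by move=> [s]; rewrite oplusC => /ortho_oplus h; exists s. Qed.

Lemma oplus_le x y z : oplus x y = Some z -> ea_le x (ortho y).
Proof. by move/ortho_oplus => h; exists (ortho z); rewrite oplusC. Qed.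

Lemma oplus_lel x y z : oplus x y = Some z -> ea_le x z.
Proof. by exists y. Qed.

Lemma oplus_ler x y z : oplus x y = Some z -> ea_le y z.
Proof. by exists x; rewrite oplusC. Qed.

End OptionMonoid.

(** * Subsums of finite partitions of unity *)

Section Osum.
Variables (E : effect_algebra) (T : finType).
Implicit Types (p q r : T -> E) (A B : {set T}).

Definition osum p A : option E := \big[@oadd E/Some ea0]_(i in A) Some (p i).

Lemma osumID p A B : osum p A = oadd (osum p (A :&: B)) (osum p (A :\: B)).
Proof. exact: big_setID. Qed.

Lemma osumU p A B : [disjoint A & B] ->
  osum p (A :|: B) = oadd (osum p A) (osum p B).
Proof.
by move=> dAB; rewrite /osum -bigU //; apply: eq_bigl => i; rewrite !inE.
Qed.

Definition covers p x := exists A, osum p A = Some x.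

Definition unity_in (Q : set E) p :=
  osum p [set: T] = Some ea1 /\ forall i, Q (p i).

Lemma osum_sub (Q : sub_effect_algebra E) p A x :
  (forall i, sub_set Q (p i)) -> osum p A = Some x -> sub_set Q x.
Proof.
move=> Qp; rewrite /osum.
elim/big_ind: _ x => [x [<-]|a b ha hb x|i _ x [<-] //]; first exact: sub_ea0.
move=> /oadd_some [y [z [ay bz yz]]].
exact: sub_oplus12 yz (ha _ ay) (hb _ bz).
Qed.

(** Any subsum is a summand of the total, which is defined. *)
Lemma osum_defined p Q A : unity_in Q p -> exists x, osum p A = Some x.
Proof.
move=> [+ _]; rewrite (osumID p _ A) finset.setTI => /oadd_some.
by move=> [x [_ [h _ _]]]; exists x.
Qed.

Lemma osum_ortho p Q A x : unity_in Q p -> osum p A = Some x ->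
  osum p (~: A) = Some (ortho x).
Proof.
move=> [+ _]; rewrite (osumID p _ A) finset.setTI finset.setTD => + Ax.
by rewrite Ax => /oadd_some [_ [y [[<-] -> /orthoP ->]]].
Qed.

(* The two halves [q i] and [r i] of [p i] sit at [(i, true)] and
   [(i, false)]. *)
Definition fork q r (ib : T * bool) : E := if ib.2 then q ib.1 else r ib.1.

Lemma osum_fork p q r A : (forall i, oplus (q i) (r i) = Some (p i)) ->
  \big[@oadd E/Some ea0]_(ib in [set ib : T * bool | ib.1 \in A])
     Some (fork q r ib) = osum p A.
Proof.
move=> qr; rewrite /osum (eq_bigr (fun i => \big[@oadd E/Some ea0]_(b : bool)
  Some (fork q r (i, b)))) => [|i _].
  by rewrite pair_big_dep; apply: eq_big => [ib|[] //]; rewrite inE andbT.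
by rewrite big_bool /= qr.
Qed.

Lemma osum_fork_true q r A :
  \big[@oadd E/Some ea0]_(ib in [set ib : T * bool | (ib.1 \in A) && ib.2])
     Some (fork q r ib) = osum q A.
Proof.
rewrite /osum (eq_bigr (fun i => \big[@oadd E/Some ea0]_(b | b)
  Some (fork q r (i, b)))) => [|i _].
  rewrite pair_big_dep; by apply: eq_big => [ib|[] //]; rewrite inE.
by rewrite (big_pred1 true) // => -[].
Qed.

End Osum.

(** * Splitting an element along a finite sum, and refining partitions *)

Section Splitting.
Variables (E : effect_algebra) (Q : set E) (P : E -> E -> Prop).
Hypothesis Ple : forall u b, P u b -> ea_le u b.
Hypothesis Psplit : forall u b v1 v2, Q v1 -> P u b -> oplus v1 v2 = Some b ->
  exists u1 u2, [/\ P u1 v1, P u2 v2 & oplus u1 u2 = Some u].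

(** Induction on the list: [Psplit] detaches the part of [u] related to the first member. [P] is
    abstract because it is used both for [below_kernel] and for the order inside a Riesz sub-effect
    algebra. *)
Lemma split_seq (T : eqType) (p : T -> E) (s : seq T) u b :
  uniq s -> (forall i, Q (p i)) ->
  \big[@oadd E/Some ea0]_(i <- s) Some (p i) = Some b -> P u b ->
  exists q : T -> E, \big[@oadd E/Some ea0]_(i <- s) Some (q i) = Some u /\
    forall i, i \in s -> P (q i) (p i).
Proof.
move=> + Qp; elim: s u b => [|i s IH] u b /=.
  rewrite big_nil => _ [<-] /Ple /ea_le0 ->.
  by exists p; rewrite big_nil.
case/andP=> nis us; rewrite big_cons => /oadd_some [_ [c [[<-] sc ic]]] Pub.
have [u1 [u2 [P1 P2 u12]]] := Psplit (Qp i) Pub ic.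
have [q [sq Pq]] := IH _ _ us sc P2.
exists (fun j => if j == i then u1 else q j); split=> [|j].
  rewrite big_cons eqxx big_seq.
  rewrite (eq_bigr (fun j => Some (q j))) => [|j js].
    by rewrite -big_seq sq.
  by case: eqP nis => // <-; rewrite js.
by rewrite inE; case: eqP => [->|_] //=; exact: Pq.
Qed.

Lemma split_osum (T : finType) (p : T -> E) (A : {set T}) u b :
  (forall i, Q (p i)) -> osum p A = Some b -> P u b ->
  exists q r : T -> E, [/\ osum q A = Some u,
    forall i, oplus (q i) (r i) = Some (p i) &
    forall i, P (q i) (p i) \/ q i = ea0].
Proof.
move=> Qp Ab Pub.
have [|q [qu Pq]] := @split_seq T p (enum A) u b (enum_uniq _) Qp _ Pub.
  by rewrite big_enum.
(* Members outside [A] are split trivially, as 0 plus themselves. *)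
have qr i : exists r, oplus (if i \in A then q i else ea0) r = Some (p i).
  case: ifP => iA; last by exists (p i); rewrite oplusC oplusx0.
  by apply/Ple/Pq; rewrite mem_enum.
have [r hr] := choice qr.
exists (fun i => if i \in A then q i else ea0), r; split=> [|//|i].
  by rewrite -qu big_enum /osum; apply: eq_bigr => i ->.
by case: ifP => iA; [left; apply: Pq; rewrite mem_enum|right].
Qed.

End Splitting.

Section Refinement.
Variables (E : effect_algebra) (Q : sub_effect_algebra E).

(** Each member is cut into its share of [u] and a remainder, so old subsums survive and [u] is the
    sum of the shares over [A]. *)
Lemma split_unity (P : E -> E -> Prop) (T : finType) (p : T -> E)
    (A : {set T}) u b :
  (forall u b, P u b -> ea_le u b) ->
  (forall u b v1 v2, sub_set Q v1 -> P u b -> oplus v1 v2 = Some b ->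
    exists u1 u2, [/\ P u1 v1, P u2 v2 & oplus u1 u2 = Some u]) ->
  (forall u b, P u b -> sub_set Q b -> sub_set Q u) ->
  unity_in Q p -> osum p A = Some b -> P u b ->
  exists p' : T * bool -> E, [/\ unity_in Q p',
    forall C : {set T}, osum p' [set ib | ib.1 \in C] = osum p C &
    osum p' [set ib | (ib.1 \in A) && ib.2] = Some u].
Proof.
move=> Ple Psplit PQ [p1 Qp] Ab Pub.
have [q [r [qu qr Pq]]] := split_osum Ple Psplit Qp Ab Pub.
have Qq i : sub_set Q (q i).
  by case: (Pq i) => [/PQ|->]; [apply|exact: sub_ea0].
exists (fork q r); split; [split|by move=> C; exact: osum_fork|].
- rewrite -p1 -(osum_fork _ qr); congr (osum _ _).
  by apply/setP => ib; rewrite !inE.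
- move=> [i []] /=; rewrite /fork //=.
  exact: sub_oplus13 (qr i) (Qq i) (Qp i).
- by rewrite /osum osum_fork_true.
Qed.

End Refinement.

(** * Kernels, internal compatibility and relative Riesz decomposition *)

Section Kernel.
Variable E : effect_algebra.

Definition below_kernel (u b : E) := ea_le u b /\ ea_le b (ortho u).

(** The parts given by homogeneity inherit the relation, because vi <= b <= u' <= ui'. *)
Lemma below_kernel_split (hE : homogeneous E) (u b v1 v2 : E) :
  below_kernel u b -> oplus v1 v2 = Some b ->
  exists u1 u2, [/\ below_kernel u1 v1, below_kernel u2 v2 &
    oplus u1 u2 = Some u].
Proof.
move=> [ub bu] v12; have [u1 [u2 [h1 h2 h12]]] := hE _ _ _ _ v12 ub bu.
have bo i : ea_le i u -> ea_le b (ortho i).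
  by move/ea_le_ortho; exact: ea_le_trans.
exists u1, u2; split=> //; split=> //.
- by apply: ea_le_trans (oplus_lel v12) (bo _ (oplus_lel h12)).
- by apply: ea_le_trans (oplus_ler v12) (bo _ (oplus_ler h12)).
Qed.

Definition kernel_closed (Q : set E) :=
  forall u b, below_kernel u b -> Q b -> Q u.

Definition internally_compatible (Q : set E) := forall F : seq E,
  (forall x, List.In x F -> Q x) ->
  exists (T : finType) (p : T -> E), unity_in Q p /\
    forall x, List.In x F -> covers p x.

Definition rdp_in (Q : set E) := forall u v1 v2 v : E,
  Q u -> Q v1 -> Q v2 -> oplus v1 v2 = Some v -> ea_le u v ->
  exists u1 u2, [/\ Q u1, Q u2, ea_le u1 v1, ea_le u2 v2 &
    oplus u1 u2 = Some u].

(** On elements of [Q] the induced order is that of [E], because differences of elements of [Q] stay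
    in [Q]. *)
Lemma rdp_inP (Q : sub_effect_algebra E) :
  riesz_decomposition (induced_effect_algebra Q) <-> rdp_in Q.
Proof.
have val_le (x y : induced_effect_algebra Q) :
    ea_le x y <-> ea_le (val x) (val y).
  split=> [[z /sub_opP h]|[z h]]; first by exists (val z).
  have Qz : sub_set Q z by apply: sub_oplus13 h _ _; apply: set_mem; exact: valP.
  by exists (exist _ z (mem_set Qz)); apply/sub_opP.
split=> [rdp u v1 v2 v Qu Q1 Q2 h uv|rdp u v1 v2 v /sub_opP h /val_le uv].
  have Qv := sub_oplus12 h Q1 Q2.
  pose S x Qx : induced_effect_algebra Q := exist _ x (mem_set Qx).
  have [] := rdp (S u Qu) (S v1 Q1) (S v2 Q2) (S v Qv).
  - exact/sub_opP.
  - exact/val_le.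
  move=> u1 [u2 [/val_le h1 /val_le h2 /sub_opP h12]].
  by exists (val u1), (val u2); split=> //; apply: set_mem; exact: valP.
have Qval (x : induced_effect_algebra Q) : sub_set Q (val x).
  by apply: set_mem; exact: valP.
have [u1 [u2 [Q1 Q2 h1 h2 h12]]] := rdp _ _ _ _ (Qval u) (Qval v1) (Qval v2) h uv.
exists (exist _ u1 (mem_set Q1)), (exist _ u2 (mem_set Q2)).
by split; [exact/val_le|exact/val_le|exact/sub_opP].
Qed.

(** Start from the partition with the single member 1 and refine once per element: each [x] is below
    1, the sum of the whole partition, so it splits along it. *)
Lemma rdp_compatible (Q : sub_effect_algebra E) :
  rdp_in Q -> internally_compatible Q.
Proof.
move=> rdp; elim=> [|x F IH] QF.
  exists unit, (fun=> ea1); split=> //; split=> [|_]; last exact: sub_ea1.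
  by rewrite /osum (big_pred1 tt) // => -[]; rewrite inE.
have [|T [p [p1 pF]]] := IH; first by move=> y Fy; apply: QF; right.
pose P u b := [/\ sub_set Q u, sub_set Q b & ea_le u b].
have Qx : sub_set Q x by apply: QF; left.
have [||||||p' [p1' pp' px]] := @split_unity E Q P T p [set: T] x ea1.
- by move=> u b [].
- move=> u b v1 v2 Q1 [Qu Qb ub] h12.
  have Q2 := sub_oplus13 h12 Q1 Qb.
  have [u1 [u2 [? ? ? ? ?]]] := rdp _ _ _ _ Qu Q1 Q2 h12 ub.
  by exists u1, u2.
- by move=> u b [].
- by [].
- by case: p1.
- by split=> //; [exact: sub_ea1|exists (ortho x); exact: oplus_ortho].
exists (T * bool)%type, p'; split=> // y /= [<-|/pF [C Cy]].
  by eexists; exact: px.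
by exists [set ib | ib.1 \in C]; rewrite pp'.
Qed.

End Kernel.

(** * Riesz decomposition for kernel-closed, internally compatible subalgebras *)

Section KernelClosed.
Variables (E : effect_algebra) (Q : sub_effect_algebra E).
Hypotheses (hE : homogeneous E) (Qk : kernel_closed Q).

Lemma split_kernel (T : finType) (p : T -> E) (A : {set T}) u b :
  unity_in Q p -> osum p A = Some b -> below_kernel u b ->
  exists p' : T * bool -> E, [/\ unity_in Q p',
    forall C : {set T}, osum p' [set ib | ib.1 \in C] = osum p C &
    osum p' [set ib | (ib.1 \in A) && ib.2] = Some u].
Proof.
apply: split_unity => [? ? []//|u' b' v1 v2 _|]; last exact: Qk.
exact: below_kernel_split.
Qed.

(* [x] and [y] may overlap in [p]; the common part [s] of their supports is
   below [t], the sum outside both, and [t] is below [ortho s], so a copy of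
   [s] can be found inside [t]. *)
Lemma disjoint_supports (T : finType) (p : T -> E) x y z :
  unity_in Q p -> covers p x -> covers p y -> oplus x y = Some z ->
  exists (T' : finType) (p' : T' -> E),
    [/\ unity_in Q p', (forall w, covers p w -> covers p' w) &
    exists I J : {set T'}, [/\ [disjoint I & J],
      osum p' I = Some x & osum p' J = Some y]].
Proof.
move=> p1 [I Ix] [J Jy] xy.
have [s hs] := osum_defined (I :&: J) p1.
have [x1 hx1] := osum_defined (I :\: J) p1.
have [t ht] := osum_defined (~: (I :|: J)) p1.
have ex : oadd (Some s) (Some x1) = Some x by rewrite -hs -hx1 -osumID.
have ey : oadd (Some s) (osum p (J :\: I)) = Some y.
  by rewrite -Jy (osumID p J I) finset.setIC hs.
have ey' : oadd (Some x1) (Some t) = Some (ortho y).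
  rewrite -(osum_ortho p1 Jy) (osumID p (~: J) I) -hx1 -ht.
  by congr oadd; congr osum; apply/setP => i; rewrite !inE; case: (i \in I);
     case: (i \in J).
(* Cancel [x1] in x1 + s + z' = x + z' = y' = x1 + t. *)
have est : oplus s (ortho z) = Some t.
  have : oadd (Some x1) (oadd (Some s) (Some (ortho z))) = Some (ortho y).
    rewrite (AC (1*2) ((2*1)*3)) /= [oplus s x1]ex /= oplusC.
    exact: ortho_oplus xy.
  by move/oadd_inj => /(_ _ ey').
have kst : below_kernel s t.
  split; first by exists (ortho z).
  have [w hw] := osum_defined (~: (I :|: J) :|: (I :&: J)) p1.
  rewrite osumU ?ht ?hs in hw; first exact: oplus_le hw.
  rewrite -setI_eq0; apply/eqP/setP => i; rewrite !inE.
  by case: (i \in I); case: (i \in J).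
have [p' [p1' pp' hs']] := split_kernel p1 ht kst.
exists (T * bool)%type, p'; split=> //.
  by move=> w [C Cw]; exists [set ib | ib.1 \in C]; rewrite pp'.
exists [set ib | ib.1 \in I], ([set ib | (ib.1 \in ~: (I :|: J)) && ib.2]
  :|: [set ib | ib.1 \in J :\: I]); split.
- rewrite -setI_eq0; apply/eqP/setP => ib; rewrite !inE.
  by case: (ib.1 \in I); rewrite ?andbF.
- by rewrite pp'.
- rewrite osumU ?hs' ?pp' // -setI_eq0; apply/eqP/setP => ib; rewrite !inE.
  by case: (ib.1 \in J); rewrite ?andbF ?orbT.
Qed.

(** With disjoint supports for [v1] and [v2], write vi = ki + li and u = k1 + k2 + s, where ki is
    the overlap with [u]. Cancelling k1 + k2 in u <= v gives s <= l1 + l2, and disjointness gives l1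
    + l2 <= s'. Homogeneity yields s = s1 + s2 with si <= li, where si is in [Q] by kernel closure;
    take ui = ki + si. *)
Lemma kernel_closed_rdp : internally_compatible Q -> rdp_in Q.
Proof.
move=> Qc u v1 v2 v Qu Q1 Q2 v12 [w uw].
have [|T0 [p0 [p01 cov]]] := Qc [:: u; v1; v2].
  by move=> x /= [<-|[<-|[<-|]]].
have [||T [p [p1 pp [J1 [J2 [dJ e1 e2]]]]]] :=
  @disjoint_supports T0 p0 v1 v2 v p01 _ _ v12; try by apply: cov; simpl; auto.
have [|I eI] := pp u; first by apply: cov; left.
have [s hs] := osum_defined (I :\: (J1 :|: J2)) p1.
have [k1 hk1] := osum_defined (I :&: J1) p1.
have [k2 hk2] := osum_defined (I :&: J2) p1.
have [l1 hl1] := osum_defined (J1 :\: I) p1.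
have [l2 hl2] := osum_defined (J2 :\: I) p1.
have dis (A B : {set T}) : [disjoint A & B] ->
    osum p (A :|: B) = oadd (osum p A) (osum p B) := @osumU _ _ p A B.
have Qosum A x := @osum_sub _ _ Q p A x p1.2.
have dJi i : (i \in J1) && (i \in J2) = false.
  by move: dJ; rewrite -setI_eq0 => /eqP/setP/(_ i); rewrite !inE.
have ev1 : oadd (Some k1) (Some l1) = Some v1.
  by rewrite -hk1 -hl1 finset.setIC -osumID.
have ev2 : oadd (Some k2) (Some l2) = Some v2.
  by rewrite -hk2 -hl2 finset.setIC -osumID.
have eu : oadd (oadd (Some k1) (Some k2)) (Some s) = Some u.
  rewrite -eI (osumID p I (J1 :|: J2)) hs finset.setIUr dis ?hk1 ?hk2 //.
  rewrite -setI_eq0; apply/eqP/setP => i; rewrite !inE.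
  by have := dJi i; case: (i \in J1); case: (i \in J2); rewrite ?andbF.
have esl : exists r, oadd (Some s) (oadd (Some l1) (Some l2)) = Some r.
  have [r hr] := osum_defined ((I :\: (J1 :|: J2)) :|:
    ((J1 :\: I) :|: (J2 :\: I))) p1.
  exists r; rewrite -hr -hs -hl1 -hl2 !dis //; rewrite -setI_eq0;
    apply/eqP/setP => i; rewrite !inE;
    by have := dJi i; case: (i \in I); case: (i \in J1); case: (i \in J2).
case: esl => r /oadd_some [_ [l [[<-] l12 sl]]].
have swl : oplus s w = Some l.
  have [k [_ [kk [<-] ks]]] := oadd_some eu.
  have kl : oadd (Some k) (Some l) = Some v.
    rewrite -kk -l12 -v12.
    rewrite -[oplus v1 v2]/(oadd (Some v1) (Some v2)) -ev1 -ev2.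
    by rewrite (AC (2*2) ((1*3)*(2*4))).
  apply: oadd_inj kl.
  by rewrite -[oplus s w]/(oadd (Some s) (Some w)) oaddA /= ks.
have skl : below_kernel s l.
  by split; [exists w|apply: oplus_le; rewrite oplusC; exact: sl].
have [s1 [s2 [[sl1 ls1] [sl2 ls2] s12]]] := below_kernel_split hE skl l12.
have Qs1 : sub_set Q s1 by apply: Qk (Qosum _ _ hl1).
have Qs2 : sub_set Q s2 by apply: Qk (Qosum _ _ hl2).
have sub (k n m x : E) : oplus k n = Some x -> ea_le m n ->
    exists2 y, oplus k m = Some y & ea_le y x.
  move=> kn [d md].
  have : oadd (oadd (Some k) (Some m)) (Some d) = Some x.
    by rewrite -oaddA /= md.
  by move/oadd_some=> [y [_ [ky [<-] yx]]]; exists y => //; exists d.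
have [u1 ku1 u1v] := sub _ _ _ _ ev1 sl1.
have [u2 ku2 u2v] := sub _ _ _ _ ev2 sl2.
exists u1, u2; split=> //.
- exact: sub_oplus12 ku1 (Qosum _ _ hk1) Qs1.
- exact: sub_oplus12 ku2 (Qosum _ _ hk2) Qs2.
rewrite -eu -s12 -[RHS]/(oadd (oadd (Some k1) (Some k2)) (oadd (Some s1) (Some s2))).
by rewrite (AC (2*2) ((1*3)*(2*4))) /= ku1 /= ku2.
Qed.

End KernelClosed.

(** * The kernel closure of a sub-effect algebra, and kernel closedness of blocks *)

Section Closure.
Variables (E : effect_algebra) (B : sub_effect_algebra E).
Hypothesis hE : homogeneous E.

Inductive kclosure : E -> Prop :=
| KBase x of sub_set B x : kclosure x
| KBelow u b of kclosure b & below_kernel u b : kclosure u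
| KSum x y z of kclosure x & kclosure y & oplus x y = Some z : kclosure z
| KOrtho x of kclosure x : kclosure (ortho x).

(** Differences need no rule of their own, since y' = z' + x. *)
Lemma kclosure13 x y z :
  oplus x y = Some z -> kclosure x -> kclosure z -> kclosure y.
Proof.
move=> h kx kz; rewrite -(orthoK y); apply: KOrtho.
exact: KSum (KOrtho kz) kx (ortho_oplus h).
Qed.

Definition kclosure_sub : sub_effect_algebra E.
Proof.
exists (kclosure : set E).
- by apply: KBase; exact: sub_ea1.
- by move=> x y z h kx ky; exact: KSum kx ky h.
- exact: kclosure13.
- by move=> x y z; rewrite oplusC; exact: kclosure13.
Defined.

Lemma kclosure_kernel_closed : kernel_closed kclosure_sub.
Proof. by move=> u b ub kb; exact: KBelow kb ub. Qed.

(* The finite set [G] inside [B] is independent of the partition to be refined: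
   this lets one refine for several elements of the closure in turn. *)
Lemma kclosure_refine x : kclosure x -> exists G : seq E,
  (forall y, List.In y G -> sub_set B y) /\
  forall (T : finType) (p : T -> E), unity_in kclosure_sub p ->
    (forall y, List.In y G -> covers p y) ->
  exists (T' : finType) (p' : T' -> E), [/\ unity_in kclosure_sub p',
    (forall w, covers p w -> covers p' w) & covers p' x].
Proof.
elim=> {x} [x Bx|u b kb [G [GB IH]] ub|x y z kx [G [GB IHx]] ky [H [HB IHy]] xy
  |x kx [G [GB IH]]].
- exists [:: x]; split=> [y [<-|]//|T p p1 cov].
  by exists T, p; split=> //; apply: cov; left.
- exists G; split=> // T p p1 /(IH _ _ p1) [T1 [p2 [p21 m2 [A bA]]]].
  have [p3 [p31 m3 c3]] :=
    split_kernel hE kclosure_kernel_closed p21 bA ub.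
  exists (T1 * bool)%type, p3; split=> //.
    by move=> w /m2 [C Cw]; exists [set ib | ib.1 \in C]; rewrite m3.
  by eexists; exact: c3.
- exists (G ++ H); split=> [w /List.in_app_iff [/GB|/HB]//|T p p1 cov].
  have [|T1 [p2 [p21 m2 c2]]] := IHx _ _ p1.
    by move=> w Gw; apply: cov; apply/List.in_app_iff; left.
  have [|T3 [p3 [p31 m3 c3]]] := IHy _ _ p21.
    by move=> w Hw; apply/m2/cov; apply/List.in_app_iff; right.
  (* The supports of [x] and [y] may overlap; once they are disjoint, their union sums to [z]. *)
  have [T4 [p4 [p41 m4 [I [J [dIJ Ix Jy]]]]]] :=
    disjoint_supports hE kclosure_kernel_closed p31 (m3 _ c2) c3 xy.
  exists T4, p4; split=> //; first by move=> w /m2 /m3 /m4.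
  by exists (I :|: J); rewrite osumU // Ix Jy.
- exists G; split=> // T p p1 /(IH _ _ p1) [T1 [p2 [p21 m2 [A bA]]]].
  exists T1, p2; split=> //.
  by exists (~: A); exact: osum_ortho p21 bA.
Qed.

Lemma kclosure_compatible : internally_compatible B ->
  internally_compatible kclosure_sub.
Proof.
move=> Bc F FQ.
(* One finite [G] in [B] is collected for the whole of [F]; compatibility of [B] then supplies the
   initial partition. *)
suff [G [GB hG]] : exists G : seq E,
  (forall y, List.In y G -> sub_set B y) /\
  forall (T : finType) (p : T -> E), unity_in kclosure_sub p ->
    (forall y, List.In y G -> covers p y) ->
  exists (T' : finType) (p' : T' -> E), [/\ unity_in kclosure_sub p',
    (forall w, covers p w -> covers p' w) &
    forall x, List.In x F -> covers p' x].
  have [T [p [[p1 Bp] cov]]] := Bc G GB.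
  have [|T' [p' [p1' _ cF]]] := hG T p _ cov; last by exists T', p'.
  by split=> // i; exact: KBase.
elim: F FQ => [|x F IH] FQ.
  by exists [::]; split=> // T p p1 _; exists T, p.
have [|H [HB hH]] := IH; first by move=> y Fy; apply: FQ; right.
have [|G [GB hG]] := @kclosure_refine x; first by apply: FQ; left.
exists (G ++ H); split=> [w /List.in_app_iff [/GB|/HB]//|T p p1 cov].
have [|T1 [p2 [p21 m2 c2]]] := hG _ _ p1.
  by move=> w Gw; apply: cov; apply/List.in_app_iff; left.
have [|T3 [p3 [p31 m3 c3]]] := hH _ _ p21.
  by move=> w Hw; apply/m2/cov; apply/List.in_app_iff; right.
exists T3, p3; split=> //; first by move=> w /m2 /m3.
by move=> w /= [<-|]; [exact: m3|exact: c3].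
Qed.

Lemma block_kernel_closed : block B -> kernel_closed B.
Proof.
move=> [/rdp_inP rdp maxB] u b ub Bb.
have sub : (B `<=` kclosure_sub)%classic by move=> x; exact: KBase.
apply: (maxB kclosure_sub) => //; last exact: KBelow (KBase Bb) ub.
apply/rdp_inP; apply: kernel_closed_rdp => //.
  exact: kclosure_kernel_closed.
exact/kclosure_compatible/rdp_compatible.
Qed.

End Closure.

(** * Meets and joins in a block *)

(** Split a common lower bound as w = w1 + w2 with a = w1 + r and w2 <= b. Cancelling [w1] in w <= y
    gives w2 <= r + c. The part of [w2] below [c] is also below [b], hence 0; so w2 <= r and w <=
    a. *)
Lemma rdp_meet (E : effect_algebra) (a b c x y : E) :
  riesz_decomposition E -> oplus a b = Some x -> oplus a c = Some y ->
  (forall l, lower_bound2 b c l -> l = ea0) -> is_meet x y a.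
Proof.
move=> rdp ab ac bc0; split; first by split; [exists b|exists c].
move=> w [wx wy].
have [w1 [w2 [[r w1r] w2b w12]]] := rdp _ _ _ _ ab wx.
have : oadd (Some w1) (oadd (Some r) (Some c)) = Some y.
  by rewrite oaddA /= w1r.
move=> /oadd_some [_ [d [[<-] rc w1d]]].
have [t wt] := wy.
have /oadd_some [_ [f [[<-] w2t w1f]]] :
    oadd (Some w1) (oadd (Some w2) (Some t)) = Some y by rewrite oaddA /= w12.
have w2d : ea_le w2 d by exists t; rewrite (oplus_inj w1d w1f).
have [e [g [er gc eg]]] := rdp _ _ _ _ rc w2d.
have g0 : g = ea0.
  by apply: bc0; split=> //; exact: ea_le_trans (oplus_ler eg) w2b.
move: eg; rewrite g0 oplusx0 => -[ew]; subst e.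
have [h w2h] := er; exists h.
have : oadd (oadd (Some w1) (Some w2)) (Some h) = Some a.
  by rewrite -oaddA /= w2h.
by rewrite /= w12.
Qed.

(** The orthosupplement is an order-reversing involution, so joins come from meets by De Morgan. *)
Lemma meet_lattice (E : effect_algebra) :
  (forall x y : E, exists m, is_meet x y m) -> lattice_ordered E.
Proof.
move=> meet x y; split=> //.
have [m [[mx my] mP]] := meet (ortho x) (ortho y).
exists (ortho m); split.
  by split; [rewrite -(orthoK x)|rewrite -(orthoK y)]; exact: ea_le_ortho.
move=> l [xl yl]; rewrite -(orthoK l); apply/ea_le_ortho/mP.
by split; exact: ea_le_ortho.
Qed.

Lemma block_meet (E : effect_algebra) (B : sub_effect_algebra E) :
  homogeneous E -> maximality_property E -> block B ->
  forall x y : induced_effect_algebra B, exists m, is_meet x y m.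
Proof.
move=> hE maxE blockB x y.
have Bk := block_kernel_closed hE blockB; have [rdp _] := blockB.
have Bval (z : induced_effect_algebra B) : sub_set B (val z).
  by apply: set_mem; exact: valP.
have [|T [p [p1 cov]]] := rdp_compatible ((rdp_inP B).1 rdp) (F := [:: val x; val y]).
  by move=> z [<-|[<-|[]]].
have [|I Ix] := cov (val x); first by left.
have [|J Jy] := cov (val y); first by right; left.
have [a ha] := osum_defined (I :&: J) p1.
have [b hb] := osum_defined (I :\: J) p1.
have [c hc] := osum_defined (J :\: I) p1.
have Bosum A z := @osum_sub _ _ B p A z p1.2.
have ab : oadd (Some a) (Some b) = Some (val x) by rewrite -ha -hb -osumID.
have ac : oadd (Some a) (Some c) = Some (val y).
  by rewrite -ha finset.setIC -hc -osumID.
have [d bc] : exists d, oplus b c = Some d.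
  have [d hd] := osum_defined ((I :\: J) :|: (J :\: I)) p1.
  exists d; rewrite -hd osumU ?hb ?hc // -setI_eq0; apply/eqP/setP => i.
  by rewrite !inE; case: (i \in I); case: (i \in J).
have [m [[mb mc] mmax]] := maxE b c.
have Bm : sub_set B m.
  apply: Bk (Bosum _ _ hb); split=> //.
  exact: ea_le_trans (oplus_le bc) (ea_le_ortho mc).
have [b1 mb1] := mb; have [c1 mc1] := mc.
have /oadd_some [n [_ [am [<-] nb1]]] :
    oadd (oadd (Some a) (Some m)) (Some b1) = Some (val x).
  by rewrite -oaddA /= mb1.
have nc1 : oplus n c1 = Some (val y).
  by rewrite -[LHS]/(oadd (Some n) (Some c1)) -am -oaddA /= mc1.
have Bn : sub_set B n by exact: sub_oplus12 am (Bosum _ _ ha) Bm.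
pose S z Bz : induced_effect_algebra B := exist _ z (mem_set Bz).
have Bb1 := sub_oplus13 nb1 Bn (Bval x).
have Bc1 := sub_oplus13 nc1 Bn (Bval y).
exists (S n Bn); apply: (@rdp_meet _ _ (S b1 Bb1) (S c1 Bc1)) => //.
- exact/sub_opP.
- exact/sub_opP.
(* If [l] is below both remainders, then k = m + l is still a lower bound of [b] and [c]; maximality
   of [m] gives k = m, so l = 0. *)
move=> l [[r /sub_opP lb] [s /sub_opP lc]]; apply: val_inj => /=.
have /oadd_some [k [_ [mk [<-] kb]]] :
    oadd (oadd (Some m) (Some (val l))) (Some (val r)) = Some b.
  by rewrite -oaddA /= [oplus (val l) _]lb.
have kc : oplus k (val s) = Some c.
  rewrite -[LHS]/(oadd (Some k) (Some (val s))) -mk -oaddA /=.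
  by rewrite [oplus (val l) _]lc.
have km : k = m by apply: mmax; [split; [exists (val r)|exists (val s)]|
    exists (val l)].
by apply: oplus_inj mk _; rewrite km oplusx0.
Qed.

Theorem theorem3p12 (E : effect_algebra) (B : sub_effect_algebra E) :
  homogeneous E -> maximality_property E -> block B ->
  lattice_ordered (induced_effect_algebra B) /\
  difference_meet (induced_effect_algebra B).
Proof.
move=> hE maxE blockB; have meet := block_meet hE maxE blockB.
by split; [exact: meet_lattice|move=> *; exact: meet].
Qed.
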